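(* Let $c>0$, $\sigma>0$, $g\in C^2(\mathbb{R})$, $h\in C^1(\mathbb{R})$, let $f$ be the given boundary data, and consider the Robin problem $$u_{tt}-c^2u_{xx}=0\ (x>0,\ t>0),\quad u(x,0)=g(x),\ u_t(x,0)=h(x)\ (x>0),\quad u_x(0,t)+\sigma u(0,t)=f(t)\ (t>0).$$ The first partial derivatives $u_x$ and $u_t$ of the solution $u$ of this problem (given by the explicit formula in the context) are discontinuous across the characteristic line $t=x/c$, with the jumps given by $$[u_x]_{t=x/c}=-g'(0)-\sigma g(0)+f(0)\qquad\text{and}\qquad [u_t]_{t=x/c}=c\,g'(0)+\sigma c\,g(0)-c\,f(0),$$ respectively.
   Context: Domains: $D^+=\{(x,t): x>ct,\ t>0\}$ and $D^-=\{(x,t): 0<x<ct,\ t>0\}$, separated by the characteristic line $x-ct=0$. Put $\phi(y)=\tfrac12 g(y)+\tfrac1{2c}\int_0^y h(\xi)\,d\xi$. The solution of the Robin problem is the function obtained from d'Alembert's formula: $$u(x,t)=\tfrac12[g(x+ct)+g(x-ct)]+\tfrac1{2c}\int_{x-ct}^{x+ct}h(\xi)\,d\xi,\quad (x,t)\in D^+,$$ $$u(x,t)=\tfrac12[g(x+ct)+g(-x+ct)]+\tfrac1{2c}\Big[\int_0^{x+ct}h(\xi)\,d\xi+\int_0^{ct-x}h(\xi)\,d\xi\Big]+e^{\sigma(-x+ct)}\int_0^{x-ct}e^{\sigma\xi}f(-\xi/c)\,d\xi-2\sigma e^{\sigma(-x+ct)}\int_0^{x-ct}e^{\sigma\xi}\phi(-\xi)\,d\xi,\quad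 (x,t)\in D^-.$$ For $w=u_x$ or $w=u_t$, the jump across the line is $[w]_{t=x/c}:=w(x,x/c)_{(x,t)\in D^-}-w(x,x/c)_{(x,t)\in D^+}$, where the subscripts indicate that the value on the line $t=x/c$ is taken from the $D^-$ side (derivative of the second formula) and from the $D^+$ side (derivative of the first formula), respectively. $f(0)$ is the value of the boundary data at $t=0$.
   Formalization: The boundary data f is assumed continuous on [0,∞), and u_x, u_t are claimed discontinuous across t=x/c only when f(0) ≠ g'(0)+σg(0), since otherwise both jumps vanish (e.g. g=h=f=0 gives u=0); the jump formulas hold in every case. *)

(* Defs.v *)
From Stdlib Require Import Reals.
From Coquelicot Require Import Coquelicot.
Open Scope R_scope.

(* All orders k <= n are listed because [Derive] is total:
   [ex_derive_n f n x] alone does not give the lower derivatives. *)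
Definition class_C (n : nat) (f : R -> R) : Prop :=
  (forall k x, (k <= n)%nat -> ex_derive_n f k x) /\
  (forall x, continuous (Derive_n f n) x).

(* Points are pairs (x, t). *)
Definition domain_plus (c : R) (p : R * R) : Prop :=
  c * snd p < fst p /\ 0 < snd p.

Definition domain_minus (c : R) (p : R * R) : Prop :=
  0 < fst p < c * snd p /\ 0 < snd p.

Definition phi (c : R) (g h : R -> R) (y : R) : R :=
  1 / 2 * g y + 1 / (2 * c) * RInt h 0 y.

Definition uplus (c : R) (g h : R -> R) (x t : R) : R :=
  1 / 2 * (g (x + c * t) + g (x - c * t))
  + 1 / (2 * c) * RInt h (x - c * t) (x + c * t).

(* On [domain_minus c] the last two integrals run over [x - ct, 0], so that f
   and [phi c g h] are only evaluated at nonnegative arguments. *)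
Definition uminus (c sigma : R) (g h f : R -> R) (x t : R) : R :=
  1 / 2 * (g (x + c * t) + g (- x + c * t))
  + 1 / (2 * c) * (RInt h 0 (x + c * t) + RInt h 0 (c * t - x))
  + exp (sigma * (- x + c * t))
    * RInt (fun xi => exp (sigma * xi) * f (- xi / c)) 0 (x - c * t)
  - 2 * sigma * exp (sigma * (- x + c * t))
    * RInt (fun xi => exp (sigma * xi) * phi c g h (- xi)) 0 (x - c * t).

(* The solution of u_tt = c^2 u_xx (x > 0, t > 0), u(x,0) = g(x),
   u_t(x,0) = h(x), u_x(0,t) + sigma u(0,t) = f(t), as given by d'Alembert's
   formula.  The two branches agree on the line x = ct. *)
Definition robin_solution (c sigma : R) (g h f : R -> R) (x t : R) : R :=
  if Rlt_dec (c * t) x then uplus c g h x t else uminus c sigma g h f x t.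

Definition ex_partial_x (u : R -> R -> R) (p : R * R) : Prop :=
  ex_derive (fun y => u y (snd p)) (fst p).

Definition ex_partial_t (u : R -> R -> R) (p : R * R) : Prop :=
  ex_derive (fun s => u (fst p) s) (snd p).

Definition partial_x (u : R -> R -> R) (p : R * R) : R :=
  Derive (fun y => u y (snd p)) (fst p).

Definition partial_t (u : R -> R -> R) (p : R * R) : R :=
  Derive (fun s => u (fst p) s) (snd p).

(* The value of w at p taken from the side D: its limit at p along D. *)
Definition is_value_from (D : R * R -> Prop) (w : R * R -> R) (p : R * R)
    (l : R) : Prop :=
  filterlim w (within D (locally p)) (locally l).

(* The jump is oriented as the D^- value minus the D^+ value; both one-sided
   values are required to exist. *)
Definition is_jump (c : R) (w : R * R -> R) (x j : R) : Prop :=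
  exists lm lp : R,
    is_value_from (domain_minus c) w (x, x / c) lm /\
    is_value_from (domain_plus c) w (x, x / c) lp /\
    j = lm - lp.

(* No value assigned to w on the line makes it continuous at (x, x/c). *)
Definition discontinuous_across (c : R) (w : R * R -> R) (x : R) : Prop :=
  ~ exists l : R,
      is_value_from (fun p => domain_minus c p \/ domain_plus c p)
        w (x, x / c) l.

(* Main.v *)
Require Import Defs.
From Stdlib Require Import Reals Lra Lia.
From Coquelicot Require Import Coquelicot.
Open Scope R_scope.

(** Both branches of the solution are superpositions of two travelling waves,
    [P (x + ct) + M (x - ct)], with the same incoming profile [P = phi c g h];
    only the profile of the outgoing wave changes across the line: it is
    [ahead_profile] in D^+ and [reflected_profile], which carries the boundary
    data, in D^-.  All profiles are C^1, so a superposition has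
    [u_x = P' + M'] and [u_t = c (P' - M')], with continuous values up to the
    line, where [x - ct = 0] ([is_value_from_partial_x],
    [is_value_from_partial_t]).  The incoming wave cancels in the jumps, which
    are therefore [J] and [- c J], where [J] is the difference at 0 of the
    derivatives of the two outgoing profiles.  The integrals from 0 in the
    reflected profile vanish at 0, but their derivatives there contribute
    [f 0] and [- 2 sigma phi 0 = - sigma g 0]; the [h] terms cancel and the
    [g] terms leave [- g' 0].

    Discontinuity for a nonzero jump is uniqueness of limits: the line lies in
    the closure of both domains, so a common limit would equal both one-sided
    values. *)

(** * Travelling waves *)

(** Data for a profile of class C^1, with its derivative named so that values
    at a point can be computed. *)
Definition has_C1_derivative (F F' : R -> R) : Prop :=
  (forall s, is_derive F s (F' s)) /\ (forall s, continuous F' s).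

Definition travelling_waves (c : R) (P M : R -> R) (x t : R) : R :=
  P (x + c * t) + M (x - c * t).

Lemma is_derive_travelling_waves_x c P P' M M' x t :
  has_C1_derivative P P' -> has_C1_derivative M M' ->
  is_derive (fun y => travelling_waves c P M y t) x
    (P' (x + c * t) + M' (x - c * t)).
Proof.
intros [HP _] [HM _]; unfold travelling_waves.
auto_derive.
- repeat split; eexists; [apply HP | apply HM].
- rewrite (is_derive_unique (fun y => P y) _ _ (HP _)).
  rewrite (is_derive_unique (fun y => M y) _ _ (HM _)).
  unfold Rminus; ring.
Qed.

Lemma is_derive_travelling_waves_t c P P' M M' x t :
  has_C1_derivative P P' -> has_C1_derivative M M' ->
  is_derive (fun s => travelling_waves c P M x s) t
    (c * (P' (x + c * t) - M' (x - c * t))).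
Proof.
intros [HP _] [HM _]; unfold travelling_waves.
auto_derive.
- repeat split; eexists; [apply HP | apply HM].
- rewrite (is_derive_unique (fun y => P y) _ _ (HP _)).
  rewrite (is_derive_unique (fun y => M y) _ _ (HM _)).
  unfold Rminus; ring.
Qed.

(** Openness of [D] is what makes the partial derivatives at a point of [D]
    depend only on the values of [u] in [D]. *)
Lemma is_derive_x_of_travelling_waves_on c D u P P' M M' p :
  open D ->
  (forall x t, D (x, t) -> u x t = travelling_waves c P M x t) ->
  has_C1_derivative P P' -> has_C1_derivative M M' -> D p ->
  is_derive (fun y => u y (snd p)) (fst p)
    (P' (fst p + c * snd p) + M' (fst p - c * snd p)).
Proof.
intros HD Hu HP HM Hp.
apply is_derive_ext_loc with (fun y => travelling_waves c P M y (snd p)).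
- destruct p as [x t]; destruct (HD _ Hp) as [e He].
  exists e; intros y Hy; symmetry; apply Hu, He.
  split; [exact Hy | apply ball_center].
- now apply is_derive_travelling_waves_x.
Qed.

Lemma is_derive_t_of_travelling_waves_on c D u P P' M M' p :
  open D ->
  (forall x t, D (x, t) -> u x t = travelling_waves c P M x t) ->
  has_C1_derivative P P' -> has_C1_derivative M M' -> D p ->
  is_derive (fun s => u (fst p) s) (snd p)
    (c * (P' (fst p + c * snd p) - M' (fst p - c * snd p))).
Proof.
intros HD Hu HP HM Hp.
apply is_derive_ext_loc with (fun s => travelling_waves c P M (fst p) s).
- destruct p as [x t]; destruct (HD _ Hp) as [e He].
  exists e; intros s Hs; symmetry; apply Hu, He.
  split; [apply ball_center | exact Hs].
- now apply is_derive_travelling_waves_t.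
Qed.

Lemma continuous_Rmult_l {U : UniformSpace} (k : R) (F : U -> R) (p : U) :
  continuous F p -> continuous (fun q => k * F q) p.
Proof. exact (continuous_scal_r (V := R_NormedModule) k F p). Qed.

Lemma is_value_from_of_continuous D (w w' : R * R -> R) p :
  (forall q, D q -> w q = w' q) -> continuous w' p ->
  is_value_from D w p (w' p).
Proof.
intros Hw Hc.
apply filterlim_within_ext with w'.
- intros q Hq; symmetry; now apply Hw.
- exact (filterlim_filter_le_1 _ (filter_le_within D) Hc).
Qed.

Lemma continuous_comp_characteristic (F : R -> R) (a : R) (p : R * R) :
  (forall s, continuous F s) ->
  continuous (fun q : R * R => F (fst q + a * snd q)) p.
Proof.
intros HF.
apply (continuous_comp (fun q : R * R => fst q + a * snd q) F).
- apply (continuous_plus (V := R_NormedModule)).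
  + apply continuous_fst.
  + apply continuous_Rmult_l, continuous_snd.
- apply HF.
Qed.

Lemma is_value_from_partial_x c D u P P' M M' x t :
  open D ->
  (forall x t, D (x, t) -> u x t = travelling_waves c P M x t) ->
  has_C1_derivative P P' -> has_C1_derivative M M' ->
  is_value_from D (partial_x u) (x, t) (P' (x + c * t) + M' (x - c * t)).
Proof.
intros HD Hu HP HM.
apply (is_value_from_of_continuous D _
  (fun q => P' (fst q + c * snd q) + M' (fst q - c * snd q))).
- intros q Hq; apply is_derive_unique.
  now apply (is_derive_x_of_travelling_waves_on c D _ P P' M M').
- apply (continuous_plus (V := R_NormedModule)).
  + apply continuous_comp_characteristic, HP.
  + apply continuous_ext with (fun q => M' (fst q + - c * snd q)).
    { intros q; f_equal; ring. }
    apply continuous_comp_characteristic, HM.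
Qed.

Lemma is_value_from_partial_t c D u P P' M M' x t :
  open D ->
  (forall x t, D (x, t) -> u x t = travelling_waves c P M x t) ->
  has_C1_derivative P P' -> has_C1_derivative M M' ->
  is_value_from D (partial_t u) (x, t)
    (c * (P' (x + c * t) - M' (x - c * t))).
Proof.
intros HD Hu HP HM.
apply (is_value_from_of_continuous D _
  (fun q => c * (P' (fst q + c * snd q) - M' (fst q - c * snd q)))).
- intros q Hq; apply is_derive_unique.
  now apply (is_derive_t_of_travelling_waves_on c D _ P P' M M').
- apply continuous_Rmult_l.
  apply (continuous_minus (V := R_NormedModule)).
  + apply continuous_comp_characteristic, HP.
  + apply continuous_ext with (fun q => M' (fst q + - c * snd q)).
    { intros q; f_equal; ring. }
    apply continuous_comp_characteristic, HM.
Qed.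

(** * The two domains and the line between them *)

Lemma open_linear_pos (a b : R) :
  open (fun p : R * R => 0 < a * fst p + b * snd p).
Proof.
apply (open_comp (fun p : R * R => a * fst p + b * snd p) (fun y => 0 < y)).
- intros p _; apply (continuous_plus (V := R_NormedModule)
    (fun q : R * R => a * fst q) (fun q : R * R => b * snd q)).
  + apply continuous_Rmult_l, continuous_fst.
  + apply continuous_Rmult_l, continuous_snd.
- apply open_gt.
Qed.

Lemma open_domain_plus c : open (domain_plus c).
Proof.
eapply open_ext; [| apply open_and;
  [apply (open_linear_pos 1 (- c)) | apply (open_linear_pos 0 1)]].
intros p; unfold domain_plus; split; intros [H1 H2]; split; lra.
Qed.

Lemma open_domain_minus c : open (domain_minus c).
Proof.
eapply open_ext; [| apply open_and; [apply open_and;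
  [apply (open_linear_pos 1 0) | apply (open_linear_pos (- 1) c)]
  | apply (open_linear_pos 0 1)]].
intros p; unfold domain_minus; split; intros [[H1 H2] H3];
  repeat split; lra.
Qed.

Lemma domain_minus_adherent c x (e : posreal) :
  0 < c -> 0 < x -> exists q, domain_minus c q /\ ball (x, x / c) e q.
Proof.
intros hc hx; pose proof (cond_pos e).
exists (x, x / c + e / 2); split.
- assert (0 < x / c) by now apply Rdiv_lt_0_compat.
  assert (0 < c * (e / 2)) by (apply Rmult_lt_0_compat; lra).
  assert (c * (x / c) = x) by (field; lra).
  unfold domain_minus; cbn [fst snd].
  rewrite Rmult_plus_distr_l; lra.
- split; [apply ball_center |].
  change (Rabs (x / c + e / 2 - x / c) < e).
  rewrite Rabs_pos_eq; lra.
Qed.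

Lemma domain_plus_adherent c x (e : posreal) :
  0 < c -> 0 < x -> exists q, domain_plus c q /\ ball (x, x / c) e q.
Proof.
intros hc hx; pose proof (cond_pos e).
exists (x + e / 2, x / c); split.
- assert (0 < x / c) by now apply Rdiv_lt_0_compat.
  assert (c * (x / c) = x) by (field; lra).
  unfold domain_plus; cbn [fst snd]; lra.
- split; [| apply ball_center].
  change (Rabs (x + e / 2 - x) < e).
  rewrite Rabs_pos_eq; lra.
Qed.

Lemma is_value_from_unique D w p l1 l2 :
  (forall e : posreal, exists q, D q /\ ball p e q) ->
  is_value_from D w p l1 -> is_value_from D w p l2 -> l1 = l2.
Proof.
intros Hadh H1 H2.
assert (HF : ProperFilter' (within D (locally p))).
{ constructor; [| apply within_filter, locally_filter].
  intros [e He]; destruct (Hadh e) as [q [HDq Hq]]; exact (He q Hq HDq). }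
exact (filterlim_locally_unique w l1 l2 H1 H2).
Qed.

Lemma is_value_from_subset (D D' : R * R -> Prop) w p l :
  (forall q, D q -> D' q) -> is_value_from D' w p l -> is_value_from D w p l.
Proof.
intros HD; apply filterlim_filter_le_1.
intros A; unfold within; apply filter_imp; auto.
Qed.

Lemma discontinuous_across_of_jump c w x j :
  0 < c -> 0 < x -> is_jump c w x j -> j <> 0 -> discontinuous_across c w x.
Proof.
intros hc hx [lm [lp [Hm [Hp Hj]]]] Hj0 [l Hl].
apply Hj0; rewrite Hj.
replace lm with l; [replace lp with l; [ring |] |].
- apply (is_value_from_unique (domain_plus c) w (x, x / c)); [| | exact Hp].
  + intros e; now apply domain_plus_adherent.
  + revert Hl; apply is_value_from_subset; auto.
- apply (is_value_from_unique (domain_minus c) w (x, x / c)); [| | exact Hm].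
  + intros e; now apply domain_minus_adherent.
  + revert Hl; apply is_value_from_subset; auto.
Qed.

(** * The profiles of the Robin solution *)

Lemma is_derive_RInt_of_continuous (k : R -> R) s :
  (forall x, continuous k x) -> is_derive (fun y => RInt k 0 y) s (k s).
Proof.
intros Hk; apply is_derive_RInt with 0.
- exists (mkposreal 1 Rlt_0_1); intros y _.
  apply (RInt_correct (V := R_CompleteNormedModule)).
  apply (ex_RInt_continuous (V := R_CompleteNormedModule)); auto.
- apply Hk.
Qed.

Lemma has_C1_derivative_continuous F F' s :
  has_C1_derivative F F' -> continuous F s.
Proof.
intros [HF _]; apply (ex_derive_continuous (V := R_NormedModule)).
exists (F' s); apply HF.
Qed.

Lemma has_C1_derivative_of_class_C2 g :
  class_C 2 g -> has_C1_derivative g (Derive g).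
Proof.
intros [Hd _]; split; intros s.
- apply Derive_correct, (Hd 1%nat); lia.
- apply (ex_derive_continuous (V := R_NormedModule)), (Hd 2%nat); lia.
Qed.

Lemma continuous_of_class_C1 h : class_C 1 h -> forall s, continuous h s.
Proof.
intros [Hd _] s.
apply (ex_derive_continuous (V := R_NormedModule)), (Hd 1%nat); lia.
Qed.

Lemma continuous_comp_opp (F : R -> R) s :
  (forall x, continuous F x) -> continuous (fun x => F (- x)) s.
Proof.
intros HF; apply (continuous_comp Ropp F); [| apply HF].
apply (continuous_opp (V := R_NormedModule)), continuous_id.
Qed.

Lemma continuous_exp_scal a s : continuous (fun x => exp (a * x)) s.
Proof.
apply (ex_derive_continuous (V := R_NormedModule)); now auto_derive.
Qed.

(** Extending the boundary data evenly gives a function continuous on the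
    whole line, so that its weighted primitive is differentiable on both sides
    of 0; in D^- the extension is not seen. *)
Lemma continuous_even_extension (f : R -> R) s :
  continuous_on (fun t => 0 <= t) f -> continuous (fun x => f (Rabs x)) s.
Proof.
intros Hf.
apply filterlim_comp with (within (fun t => 0 <= t) (locally (Rabs s))).
- intros A HA; apply (continuous_Rabs s) in HA.
  revert HA; unfold filtermap; apply filter_imp.
  intros y Hy; apply Hy, Rabs_pos.
- apply Hf, Rabs_pos.
Qed.

Definition ahead_profile (c : R) (g h : R -> R) (s : R) : R :=
  1 / 2 * g s - 1 / (2 * c) * RInt h 0 s.

Definition ahead_slope (c : R) (g h : R -> R) (s : R) : R :=
  1 / 2 * Derive g s - 1 / (2 * c) * h s.

Definition boundary_integrand (c sigma : R) (f : R -> R) (xi : R) : R :=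
  exp (sigma * xi) * f (Rabs (- xi / c)).

Definition phi_integrand (c sigma : R) (g h : R -> R) (xi : R) : R :=
  exp (sigma * xi) * phi c g h (- xi).

Definition reflected_profile (c sigma : R) (g h f : R -> R) (s : R) : R :=
  phi c g h (- s)
  + exp (- sigma * s)
    * (RInt (boundary_integrand c sigma f) 0 s
       - 2 * sigma * RInt (phi_integrand c sigma g h) 0 s).

Lemma phi_C1 c g h :
  has_C1_derivative g (Derive g) -> (forall s, continuous h s) ->
  has_C1_derivative (phi c g h)
    (fun s => 1 / 2 * Derive g s + 1 / (2 * c) * h s).
Proof.
intros [Hg Hg'] Hh; split; intros s.
- apply (is_derive_plus (V := R_NormedModule));
    apply is_derive_scal; [apply Hg | now apply is_derive_RInt_of_continuous].
- apply (continuous_plus (V := R_NormedModule));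
    apply continuous_Rmult_l; auto.
Qed.

Lemma ahead_profile_C1 c g h :
  has_C1_derivative g (Derive g) -> (forall s, continuous h s) ->
  has_C1_derivative (ahead_profile c g h) (ahead_slope c g h).
Proof.
intros [Hg Hg'] Hh; split; intros s.
- apply (is_derive_minus (V := R_NormedModule));
    apply is_derive_scal; [apply Hg | now apply is_derive_RInt_of_continuous].
- apply (continuous_minus (V := R_NormedModule));
    apply continuous_Rmult_l; auto.
Qed.

Lemma continuous_boundary_integrand c sigma f s :
  continuous_on (fun t => 0 <= t) f ->
  continuous (boundary_integrand c sigma f) s.
Proof.
intros Hf; apply (continuous_mult (K := R_AbsRing)).
- apply continuous_exp_scal.
- apply (continuous_comp (fun x => - x / c) (fun x => f (Rabs x))).
  + apply (ex_derive_continuous (V := R_NormedModule)); now auto_derive.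
  + now apply continuous_even_extension.
Qed.

Lemma continuous_phi_integrand c sigma g h s :
  has_C1_derivative g (Derive g) -> (forall s, continuous h s) ->
  continuous (phi_integrand c sigma g h) s.
Proof.
intros Hg Hh; apply (continuous_mult (K := R_AbsRing)).
- apply continuous_exp_scal.
- apply continuous_comp_opp; intros x.
  now apply (has_C1_derivative_continuous _ _ x (phi_C1 c g h Hg Hh)).
Qed.

(** The three summands differentiate, in turn, [phi c g h (- s)], the factor
    [exp (- sigma s)] and the integrals; the second vanishes at 0 and the third
    brings in the boundary data. *)
Definition reflected_slope (c sigma : R) (g h f : R -> R) (s : R) : R :=
  - (1 / 2 * Derive g (- s) + 1 / (2 * c) * h (- s))
  - sigma * exp (- sigma * s)
    * (RInt (boundary_integrand c sigma f) 0 s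
       - 2 * sigma * RInt (phi_integrand c sigma g h) 0 s)
  + exp (- sigma * s)
    * (boundary_integrand c sigma f s
       - 2 * sigma * phi_integrand c sigma g h s).

Lemma reflected_profile_C1 c sigma g h f :
  has_C1_derivative g (Derive g) -> (forall s, continuous h s) ->
  continuous_on (fun t => 0 <= t) f ->
  has_C1_derivative (reflected_profile c sigma g h f)
    (reflected_slope c sigma g h f).
Proof.
intros Hg Hh Hf.
pose proof (phi_C1 c g h Hg Hh) as [Hphi Hphi'].
assert (Hb : forall s, continuous (boundary_integrand c sigma f) s)
  by (intros s; now apply continuous_boundary_integrand).
assert (Hp : forall s, continuous (phi_integrand c sigma g h) s)
  by (intros s; now apply continuous_phi_integrand).
assert (HB := fun s => is_derive_RInt_of_continuous _ s Hb).
assert (HPhi := fun s => is_derive_RInt_of_continuous _ s Hp).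
split; intros s; unfold reflected_profile, reflected_slope.
(* [B] and [Phi] are made opaque so that [auto_derive] treats the primitives
   as unknown differentiable functions. *)
- set (B := (fun y => RInt (boundary_integrand c sigma f) 0 y) : R -> R) in *.
  set (Phi := (fun y => RInt (phi_integrand c sigma g h) 0 y) : R -> R) in *.
  change (is_derive
    (fun y => phi c g h (- y) + exp (- sigma * y) * (B y - 2 * sigma * Phi y)) s
    (- (1 / 2 * Derive g (- s) + 1 / (2 * c) * h (- s))
     - sigma * exp (- sigma * s) * (B s - 2 * sigma * Phi s)
     + exp (- sigma * s) * (boundary_integrand c sigma f s
         - 2 * sigma * phi_integrand c sigma g h s))).
  clearbody B Phi.
  auto_derive.
  + repeat split; eexists; [apply Hphi | apply HB | apply HPhi].
  + rewrite (is_derive_unique (fun y => phi c g h y) _ _ (Hphi _)).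
    rewrite (is_derive_unique (fun y => B y) _ _ (HB _)).
    rewrite (is_derive_unique (fun y => Phi y) _ _ (HPhi _)).
    ring.
- assert (CB : continuous (fun y => RInt (boundary_integrand c sigma f) 0 y) s)
    by (apply (ex_derive_continuous (V := R_NormedModule));
        eexists; apply HB).
  assert (CPhi : continuous (fun y => RInt (phi_integrand c sigma g h) 0 y) s)
    by (apply (ex_derive_continuous (V := R_NormedModule));
        eexists; apply HPhi).
  pose proof (continuous_exp_scal (- sigma) s) as CE.
  apply (continuous_plus (V := R_NormedModule));
    [apply (continuous_minus (V := R_NormedModule)) |].
  + apply (continuous_opp (V := R_NormedModule)).
    now apply (continuous_comp_opp _ s Hphi').
  + apply (continuous_mult (K := R_AbsRing)).
    * now apply continuous_Rmult_l.
    * apply (continuous_minus (V := R_NormedModule)); [exact CB |].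
      now apply continuous_Rmult_l.
  + apply (continuous_mult (K := R_AbsRing)); [exact CE |].
    apply (continuous_minus (V := R_NormedModule)); [apply Hb |].
    now apply continuous_Rmult_l.
Qed.

(** This difference is the jump of [u_x], and [- 1 / c] times that of [u_t],
    because the incoming wave is common to both sides of the line. *)
Lemma reflected_slope_minus_ahead_slope_0 c sigma g h f :
  reflected_slope c sigma g h f 0 - ahead_slope c g h 0
  = - Derive g 0 - sigma * g 0 + f 0.
Proof.
unfold reflected_slope, ahead_slope, boundary_integrand, phi_integrand, phi.
rewrite Ropp_0, !RInt_point; change (@zero R_AbelianGroup) with 0.
change (@zero R_CompleteNormedModule) with 0.
unfold Rdiv; rewrite !Rmult_0_r, Rmult_0_l, Rabs_R0, exp_0.
lra.
Qed.

(** * The two branches as travelling waves *)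

Lemma robin_solution_domain_plus c sigma g h f x t :
  (forall s, continuous h s) -> domain_plus c (x, t) ->
  robin_solution c sigma g h f x t
  = travelling_waves c (phi c g h) (ahead_profile c g h) x t.
Proof.
intros Hh [Hx _]; simpl in Hx; unfold robin_solution.
destruct (Rlt_dec (c * t) x) as [_ | n]; [| contradiction].
unfold uplus, travelling_waves, phi, ahead_profile.
assert (Hex : forall a b, ex_RInt h a b).
{ intros a b.
  apply (ex_RInt_continuous (V := R_CompleteNormedModule)); auto. }
rewrite <- (RInt_Chasles h 0 (x - c * t) (x + c * t)) by apply Hex.
change plus with Rplus; ring.
Qed.

Lemma robin_solution_domain_minus c sigma g h f x t :
  0 < c -> domain_minus c (x, t) ->
  robin_solution c sigma g h f x t
  = travelling_waves c (phi c g h) (reflected_profile c sigma g h f) x t.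
Proof.
intros hc [[_ Hx] _]; simpl in Hx; unfold robin_solution.
destruct (Rlt_dec (c * t) x) as [n | _]; [lra |].
unfold uminus, travelling_waves, reflected_profile.
replace (- (x - c * t)) with (c * t - x) by ring.
replace (- x + c * t) with (c * t - x) by ring.
replace (- sigma * (x - c * t)) with (sigma * (c * t - x)) by ring.
rewrite (RInt_ext (boundary_integrand c sigma f)
  (fun xi => exp (sigma * xi) * f (- xi / c))).
- unfold phi_integrand; unfold phi at 2 3; ring.
- rewrite Rmin_right, Rmax_left by lra.
  intros xi Hxi; unfold boundary_integrand.
  rewrite Rabs_pos_eq; [reflexivity |].
  apply Rlt_le, Rdiv_lt_0_compat; lra.
Qed.

Theorem proposition6 (c sigma : R) (g h f : R -> R)
  (hc : 0 < c) (hsigma : 0 < sigma)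
  (hg : class_C 2 g) (hh : class_C 1 h)
  (hf : continuous_on (fun t => 0 <= t) f) :
  let u := robin_solution c sigma g h f in
  (forall p : R * R, domain_minus c p \/ domain_plus c p ->
     ex_partial_x u p /\ ex_partial_t u p) /\
  (forall x : R, 0 < x ->
     is_jump c (partial_x u) x (- Derive g 0 - sigma * g 0 + f 0) /\
     is_jump c (partial_t u) x
       (c * Derive g 0 + sigma * c * g 0 - c * f 0) /\
     (- Derive g 0 - sigma * g 0 + f 0 <> 0 ->
        discontinuous_across c (partial_x u) x /\
        discontinuous_across c (partial_t u) x)).
Proof.
intros u.
pose proof (has_C1_derivative_of_class_C2 g hg) as Hg.
pose proof (continuous_of_class_C1 h hh) as Hh.
pose proof (phi_C1 c g h Hg Hh) as HP.
pose proof (ahead_profile_C1 c g h Hg Hh) as HA.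
pose proof (reflected_profile_C1 c sigma g h f Hg Hh hf) as HM.
assert (Hup : forall x t, domain_plus c (x, t) ->
  u x t = travelling_waves c (phi c g h) (ahead_profile c g h) x t)
  by (intros x t; now apply robin_solution_domain_plus).
assert (Hum : forall x t, domain_minus c (x, t) ->
  u x t = travelling_waves c (phi c g h) (reflected_profile c sigma g h f) x t)
  by (intros x t; now apply robin_solution_domain_minus).
pose proof (open_domain_plus c) as Op.
pose proof (open_domain_minus c) as Om.
split.
- intros p [Hp | Hp]; split; eexists.
  + exact (is_derive_x_of_travelling_waves_on _ _ _ _ _ _ _ _ Om Hum HP HM Hp).
  + exact (is_derive_t_of_travelling_waves_on _ _ _ _ _ _ _ _ Om Hum HP HM Hp).
  + exact (is_derive_x_of_travelling_waves_on _ _ _ _ _ _ _ _ Op Hup HP HA Hp).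
  + exact (is_derive_t_of_travelling_waves_on _ _ _ _ _ _ _ _ Op Hup HP HA Hp).
- intros x hx.
  assert (Hline : x - c * (x / c) = 0) by (field; lra).
  assert (Jx : is_jump c (partial_x u) x (- Derive g 0 - sigma * g 0 + f 0)).
  { eexists; eexists; split; [| split].
    - exact (is_value_from_partial_x _ _ _ _ _ _ _ _ _ Om Hum HP HM).
    - exact (is_value_from_partial_x _ _ _ _ _ _ _ _ _ Op Hup HP HA).
    - rewrite Hline, <- (reflected_slope_minus_ahead_slope_0 c sigma g h f).
      ring. }
  assert (Jt : is_jump c (partial_t u) x
    (c * Derive g 0 + sigma * c * g 0 - c * f 0)).
  { eexists; eexists; split; [| split].
    - exact (is_value_from_partial_t _ _ _ _ _ _ _ _ _ Om Hum HP HM).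
    - exact (is_value_from_partial_t _ _ _ _ _ _ _ _ _ Op Hup HP HA).
    - rewrite Hline.
      pose proof (reflected_slope_minus_ahead_slope_0 c sigma g h f) as J0.
      replace (c * Derive g 0 + sigma * c * g 0 - c * f 0)
        with (- c * (- Derive g 0 - sigma * g 0 + f 0)) by ring.
      rewrite <- J0; ring. }
  split; [exact Jx | split; [exact Jt |]].
  intros HJ; split.
  + exact (discontinuous_across_of_jump _ _ _ _ hc hx Jx HJ).
  + apply (discontinuous_across_of_jump _ _ _ _ hc hx Jt).
    replace (c * Derive g 0 + sigma * c * g 0 - c * f 0)
      with (- c * (- Derive g 0 - sigma * g 0 + f 0)) by ring.
    apply Rmult_integral_contrapositive_currified; lra.
Qed.
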